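(* Let $X\in\mathbb R^{m\times n}$ have no zero rows, let $\Psi$ be its row-normalization, and let $\Gamma(X)=\Psi\Psi^\top$. Suppose that $\Gamma(X)\succ0$. The closest update to $\Psi$ within the unit spectral-norm ball is $$T_+:=\arg\min_{\|T\|_{\mathrm{op}}\le1}\frac12\|T-\Psi\|_F^2=\arg\max_{\|T\|_{\mathrm{op}}\le1}\left\{\langle\Psi,T\rangle_F-\frac12\|T\|_F^2\right\},$$ where $T$ ranges over $\mathbb R^{m\times n}$ (the two problems have the same solution). Its unique solution is $T_+=P_+\Psi$, where $$P_+=\widetilde U\operatorname{Diag}\left(\min\{1,\lambda_1^{-1/2}\},\dots,\min\{1,\lambda_m^{-1/2}\}\right)\widetilde U^\top .$$ In particular, $0\prec P_+\preceq I_m$ and the singular values of $T_+$ satisfy $\sigma_i(T_+)=\min\{\widetilde\sigma_i,1\}$ for $i=1,\dots,m$.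
   Context: For $X\in\mathbb R^{m\times n}$ with rows $x_1^\top,\dots,x_m^\top$ all nonzero, $D(X):=\operatorname{Diag}(\|x_1\|_2,\dots,\|x_m\|_2)$, $\Psi:=D(X)^{-1}X$ and $\Gamma(X):=\Psi\Psi^\top$. Let $\Psi=\widetilde U\widetilde\Sigma\widetilde V^\top$ be a thin SVD with singular values $\widetilde\sigma_1\ge\dots\ge\widetilde\sigma_m\ge0$, so that $\Gamma(X)=\widetilde U\Lambda\widetilde U^\top$ with $\Lambda=\operatorname{Diag}(\lambda_1,\dots,\lambda_m)$ and $\lambda_i=\widetilde\sigma_i^2$. $\|\cdot\|_{\mathrm{op}}$ is the spectral norm, $\|\cdot\|_F$ and $\langle\cdot,\cdot\rangle_F$ the Frobenius norm and inner product; $\succ,\preceq$ denote the Loewner order. *)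

(* Defs.v *)
From mathcomp Require Import all_boot all_order all_algebra.
From mathcomp Require Import boolp classical_sets reals.

Set Implicit Arguments.
Unset Strict Implicit.
Unset Printing Implicit Defensive.

Import Order.TTheory GRing.Theory Num.Theory.

Local Open Scope classical_set_scope.
Local Open Scope ring_scope.

Definition frob_dot {R : realType} {m n : nat} (A B : 'M[R]_(m, n)) : R :=
  \tr (A^T *m B).

(* On row and column vectors this is the Euclidean norm, and it is used as
   such below. The library norm on matrices is the entrywise maximum. *)
Definition frob_norm {R : realType} {m n : nat} (A : 'M[R]_(m, n)) : R :=
  Num.sqrt (frob_dot A A).

Definition op_norm {R : realType} {m n : nat} (A : 'M[R]_(m, n)) : R :=
  sup [set frob_norm (A *m v) | v in [set v : 'cV[R]_n | frob_norm v <= 1]].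

Definition posdef {R : realType} {m : nat} (A : 'M[R]_m) : Prop :=
  A^T = A /\ forall v : 'cV[R]_m, v != 0 -> 0 < (v^T *m A *m v) 0 0.

Definition possemidef {R : realType} {m : nat} (A : 'M[R]_m) : Prop :=
  A^T = A /\ forall v : 'cV[R]_m, 0 <= (v^T *m A *m v) 0 0.

Definition loewner_lt {R : realType} {m : nat} (A B : 'M[R]_m) : Prop :=
  posdef (B - A).

Definition loewner_le {R : realType} {m : nat} (A B : 'M[R]_m) : Prop :=
  possemidef (B - A).

Definition row_norm_mx {R : realType} {m n : nat} (X : 'M[R]_(m, n)) : 'M[R]_m :=
  diag_mx (\row_i frob_norm (row i X)).

Definition row_normalize {R : realType} {m n : nat} (X : 'M[R]_(m, n)) :
    'M[R]_(m, n) :=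
  invmx (row_norm_mx X) *m X.

Definition Gamma {R : realType} {m n : nat} (X : 'M[R]_(m, n)) : 'M[R]_m :=
  row_normalize X *m (row_normalize X)^T.

(* Thin with respect to the row dimension m: U is m x m, V is n x m, and there
   are m singular values, so that such a factorization forces m <= n. *)
Definition thin_svd {R : realType} {m n : nat} (A : 'M[R]_(m, n))
    (U : 'M[R]_m) (s : 'rV[R]_m) (V : 'M[R]_(n, m)) : Prop :=
  [/\ U^T *m U = 1%:M, V^T *m V = 1%:M,
      forall i, 0 <= s 0 i,
      forall i j : 'I_m, (i <= j)%N -> s 0 j <= s 0 i
    & A = U *m diag_mx s *m V^T].

(* The singular values do not depend on the factorization. The default 0 is
   only reached when there is no thin SVD in the above sense, i.e. if m > n. *)
Definition singular_values {R : realType} {m n : nat} (A : 'M[R]_(m, n)) :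
    'rV[R]_m :=
  xget 0 [set s | exists U V, thin_svd A U s V].

Definition argmin {R : realType} {T : Type} (S : set T) (f : T -> R) : set T :=
  [set x | S x /\ forall y, S y -> f x <= f y].

Definition argmax {R : realType} {T : Type} (S : set T) (f : T -> R) : set T :=
  [set x | S x /\ forall y, S y -> f y <= f x].

(* Main.v *)
(** The candidate is [T_+ = U Diag(min(s_i, 1)) V^T].  For [T] in the ball the
    inner product [<T - T_+, Psi - T_+>] equals
    [sum_i (s_i - min(s_i, 1)) (u_i^T T v_i - min(s_i, 1))].  A term with a
    nonzero first factor has [min(s_i, 1) = 1 >= u_i^T T v_i], so the sum is
    nonpositive; expanding the square gives
    [|T - Psi|^2 >= |T_+ - Psi|^2 + |T - T_+|^2]. *)
Require Import Defs.
From mathcomp Require Import all_boot all_order all_algebra.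
From mathcomp Require Import boolp classical_sets reals.
From mathcomp Require Import ring lra.

Set Implicit Arguments.
Unset Strict Implicit.
Unset Printing Implicit Defensive.

Import Order.TTheory GRing.Theory Num.Theory.

Local Open Scope classical_set_scope.
Local Open Scope ring_scope.

(** * Characteristic polynomials under change of basis and of diagonal matrices *)

Lemma char_poly_conj (R : comNzRingType) m (U W D : 'M[R]_m) :
  U *m W = 1%:M -> char_poly (U *m D *m W) = char_poly D.
Proof.
move=> UW; rewrite /char_poly.
have -> : char_poly_mx (U *m D *m W) =
    map_mx polyC U *m char_poly_mx D *m map_mx polyC W.
  rewrite /char_poly_mx mulmxBr mulmxBl mul_mx_scalar -scalemxAl -!map_mxM /=.
  by rewrite UW map_mx1 scalemx1.
by rewrite !det_mulmx mulrAC -det_mulmx -map_mxM /= UW map_mx1 det1 mul1r.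
Qed.

Lemma char_poly_diag (R : comNzRingType) m (d : 'rV[R]_m) :
  char_poly (diag_mx d) = \prod_(x <- [seq d 0 i | i <- enum 'I_m]) ('X - x%:P).
Proof.
rewrite char_poly_trig ?diag_mx_is_trig // big_map big_enum /=.
by apply: eq_bigr => i _; rewrite mxE eqxx mulr1n.
Qed.

(** * Frobenius inner product, the operator-norm ball, and quadratic forms *)

Section FrobeniusGeometry.
Variable R : realType.

Lemma frob_dotE m n (A B : 'M[R]_(m, n)) :
  frob_dot A B = \sum_j \sum_i A i j * B i j.
Proof.
apply: eq_bigr => j _; rewrite mxE.
by apply: eq_bigr => i _; rewrite mxE.
Qed.

Lemma frob_dotC m n (A B : 'M[R]_(m, n)) : frob_dot A B = frob_dot B A.
Proof. by rewrite /frob_dot -mxtrace_tr trmx_mul trmxK. Qed.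

Lemma frob_dotDr m n (A B C : 'M[R]_(m, n)) :
  frob_dot A (B + C) = frob_dot A B + frob_dot A C.
Proof. by rewrite /frob_dot mulmxDr mxtraceD. Qed.

Lemma frob_dotNr m n (A B : 'M[R]_(m, n)) : frob_dot A (- B) = - frob_dot A B.
Proof. by rewrite /frob_dot mulmxN raddfN. Qed.

Lemma frob_dotBr m n (A B C : 'M[R]_(m, n)) :
  frob_dot A (B - C) = frob_dot A B - frob_dot A C.
Proof. by rewrite frob_dotDr frob_dotNr. Qed.

Lemma frob_dotBl m n (A B C : 'M[R]_(m, n)) :
  frob_dot (A - B) C = frob_dot A C - frob_dot B C.
Proof. by rewrite frob_dotC frob_dotBr !(frob_dotC C). Qed.

Lemma frob_dot_sqB m n (A B : 'M[R]_(m, n)) :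
  frob_dot (A - B) (A - B) =
  frob_dot A A - 2 * frob_dot A B + frob_dot B B.
Proof. rewrite frob_dotBr !frob_dotBl (frob_dotC B A); ring. Qed.

Lemma frob_dot_ge0 m n (A : 'M[R]_(m, n)) : 0 <= frob_dot A A.
Proof.
rewrite frob_dotE; apply: sumr_ge0 => j _.
by apply: sumr_ge0 => i _; exact: sqr_ge0.
Qed.

Lemma frob_dot_eq0 m n (A : 'M[R]_(m, n)) : frob_dot A A = 0 -> A = 0.
Proof.
rewrite frob_dotE => /eqP; rewrite psumr_eq0; last first.
  by move=> j _; apply: sumr_ge0 => i _; exact: sqr_ge0.
move=> /allP A0; apply/matrixP => i j; rewrite mxE.
have := A0 j (mem_index_enum _); rewrite /= psumr_eq0; last first.
  by move=> k _; exact: sqr_ge0.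
by move=> /allP/(_ i (mem_index_enum _)); rewrite /= mulf_eq0 orbb => /eqP.
Qed.

Lemma sqr_frob_norm m n (A : 'M[R]_(m, n)) : frob_norm A ^+ 2 = frob_dot A A.
Proof. by rewrite sqr_sqrtr ?frob_dot_ge0. Qed.

Lemma frob_norm_le1 m n (A : 'M[R]_(m, n)) :
  (frob_norm A <= 1) = (frob_dot A A <= 1).
Proof. by rewrite -[in RHS]sqr_frob_norm expr_le1 ?sqrtr_ge0. Qed.

Lemma frob_dot_cVE m (u v : 'cV[R]_m) : frob_dot u v = (u^T *m v) 0 0.
Proof. by rewrite /frob_dot /mxtrace big_ord1. Qed.

Lemma frob_dot_isometry m n p (V : 'M[R]_(n, m)) (A B : 'M[R]_(m, p)) :
  V^T *m V = 1%:M -> frob_dot (V *m A) (V *m B) = frob_dot A B.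
Proof. by move=> VV; rewrite /frob_dot trmx_mul -mulmxA (mulmxA V^T) VV mul1mx. Qed.

(** [V V^T] is an orthogonal projection, and the gap between the two sides is the squared norm of
    [v - V V^T v]. *)
Lemma frob_dot_trmx_isometry_le m n p (V : 'M[R]_(n, m)) (v : 'M[R]_(n, p)) :
  V^T *m V = 1%:M -> frob_dot (V^T *m v) (V^T *m v) <= frob_dot v v.
Proof.
move=> VV; have := frob_dot_ge0 (v - V *m (V^T *m v)).
rewrite frob_dot_sqB (frob_dot_isometry _ _ VV).
have -> : frob_dot v (V *m (V^T *m v)) = frob_dot (V^T *m v) (V^T *m v).
  by rewrite /frob_dot trmx_mul trmxK !mulmxA.
lra.
Qed.

(** Expanding [0 <= |A - B|^2] suffices here in place of Cauchy-Schwarz. *)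
Lemma frob_dot_le1 m n (A B : 'M[R]_(m, n)) :
  frob_dot A A <= 1 -> frob_dot B B <= 1 -> frob_dot A B <= 1.
Proof. by move=> A1 B1; have := frob_dot_ge0 (A - B); rewrite frob_dot_sqB; lra. Qed.

Lemma cV_entry_le1 n (v : 'cV[R]_n) j : frob_dot v v <= 1 -> `|v j 0| <= 1.
Proof.
move=> v1; rewrite -(@expr_le1 _ 2) // real_normK ?num_real //.
apply: le_trans v1; rewrite frob_dotE big_ord1 (bigD1 j) //= expr2 lerDl.
by apply: sumr_ge0 => i _; exact: sqr_ge0.
Qed.

(** The supremum defining [op_norm] bounds its set only if that set is bounded. Entries of a vector
    in the unit ball are at most 1 in absolute value, so each entry of [A v] is at most the absolute
    row sum of [A]. *)
Lemma has_ubound_op_norm m n (A : 'M[R]_(m, n)) :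
  has_ubound [set frob_norm (A *m v) | v in [set v : 'cV[R]_n | frob_norm v <= 1]].
Proof.
exists (Num.sqrt (\sum_i (\sum_j `|A i j|) ^+ 2)) => _ [v /= v1 <-].
rewrite frob_norm_le1 in v1.
rewrite ler_wsqrtr // frob_dotE big_ord1; apply: ler_sum => i _.
rewrite -expr2 -[leLHS]real_normK ?num_real // lerXn2r ?nnegrE ?sumr_ge0 // mxE.
apply: le_trans (ler_norm_sum _ _ _) _; apply: ler_sum => j _.
by rewrite normrM ler_piMr // cV_entry_le1.
Qed.

Lemma op_norm_le1P m n (A : 'M[R]_(m, n)) :
  op_norm A <= 1 <->
  (forall v : 'cV[R]_n, frob_dot v v <= 1 -> frob_dot (A *m v) (A *m v) <= 1).
Proof.
split=> [A1 v v1|A1].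
  rewrite -frob_norm_le1; apply: le_trans A1; apply: ub_le_sup.
    exact: has_ubound_op_norm.
  by exists v; rewrite //= frob_norm_le1.
(* The supremum rule also asks for a nonempty set; the zero vector provides an element. *)
apply: ge_sup.
  by exists (frob_norm (A *m (0 : 'cV_n))), 0; rewrite //= frob_norm_le1 /frob_dot mulmx0 mxtrace0.
by move=> _ [v /= v1 <-]; rewrite frob_norm_le1 A1 // -frob_norm_le1.
Qed.

Lemma quad_diag m (d : 'rV[R]_m) (w : 'cV[R]_m) :
  (w^T *m diag_mx d *m w) 0 0 = \sum_i d 0 i * w i 0 ^+ 2.
Proof.
rewrite mul_mx_diag mxE; apply: eq_bigr => i _; rewrite !mxE; ring.
Qed.

Lemma quad_conj m (U D : 'M[R]_m) (v : 'cV[R]_m) :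
  v^T *m (U *m D *m U^T) *m v = (U^T *m v)^T *m D *m (U^T *m v).
Proof. by rewrite trmx_mul trmxK !mulmxA. Qed.

Lemma trmx_conj_diag m (U : 'M[R]_m) (d : 'rV[R]_m) :
  (U *m diag_mx d *m U^T)^T = U *m diag_mx d *m U^T.
Proof. by rewrite !trmx_mul trmxK tr_diag_mx mulmxA. Qed.

Lemma possemidef_conj_diag m (U : 'M[R]_m) (d : 'rV[R]_m) :
  (forall i, 0 <= d 0 i) -> possemidef (U *m diag_mx d *m U^T).
Proof.
move=> d0; split=> [|v]; first exact: trmx_conj_diag.
rewrite quad_conj quad_diag; apply: sumr_ge0 => i _.
by rewrite mulr_ge0 ?sqr_ge0.
Qed.

Lemma posdef_conj_diag m (U : 'M[R]_m) (d : 'rV[R]_m) :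
  U *m U^T = 1%:M -> (forall i, 0 < d 0 i) -> posdef (U *m diag_mx d *m U^T).
Proof.
move=> UU d0; split=> [|v vN0]; first exact: trmx_conj_diag.
have : U^T *m v != 0.
  by apply: contraNneq vN0 => Uv0; rewrite -[v]mul1mx -UU -mulmxA Uv0 mulmx0.
rewrite quad_conj quad_diag; set w := U^T *m v => wN0.
have term_ge0 i : 0 <= d 0 i * w i 0 ^+ 2 by rewrite mulr_ge0 ?sqr_ge0 ?ltW.
rewrite lt_def sumr_ge0 // andbT; apply: contraNneq wN0 => /eqP.
rewrite psumr_eq0 // => /allP w0; apply/eqP/colP => i; rewrite [RHS]mxE.
have := w0 i (mem_index_enum _).
by rewrite /= mulf_eq0 gt_eqF //= sqrf_eq0 => /eqP.
Qed.

(** The quadratic form at the eigenvector [U e_i] equals [d_i]; this vector is nonzero because [U^T]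
    sends it to [e_i]. *)
Lemma posdef_conj_diag_gt0 m (U : 'M[R]_m) (d : 'rV[R]_m) :
  U^T *m U = 1%:M -> posdef (U *m diag_mx d *m U^T) -> forall i, 0 < d 0 i.
Proof.
move=> UU [_ pd] i.
have UKe : U^T *m (U *m delta_mx i 0) = (delta_mx i 0 : 'cV[R]_m).
  by rewrite mulmxA UU mul1mx.
have /pd : U *m delta_mx i 0 != 0 :> 'cV[R]_m.
  apply: contra_eq_neq UKe => ->; rewrite mulmx0 eq_sym; apply/eqP => /colP/(_ i).
  by move/eqP; rewrite !mxE !eqxx oner_eq0.
rewrite quad_conj UKe quad_diag (bigD1 i) //= big1 => [|j jNi].
  by rewrite !mxE !eqxx addr0 expr1n mulr1.
by rewrite !mxE (negbTE jNi) expr0n mulr0.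
Qed.

End FrobeniusGeometry.

(** * Uniqueness of singular values through the spectrum of [A A^T] *)

Lemma thin_svd_mulmx_tr (R : realType) m n (A : 'M[R]_(m, n)) U s V :
  thin_svd A U s V ->
  A *m A^T = U *m diag_mx (\row_i s 0 i ^+ 2) *m U^T.
Proof.
move=> [_ VV _ _ ->]; rewrite !trmx_mul trmxK tr_diag_mx !mulmxA.
rewrite -(mulmxA _ V^T) VV mulmx1 -(mulmxA U) mulmx_diag.
by congr (_ *m diag_mx _ *m _); apply/rowP => i; rewrite !mxE expr2.
Qed.

(** The squares of the singular values are the roots, with multiplicity, of the characteristic
    polynomial of [A A^T], hence determined up to permutation. Both lists are sorted, so they agree,
    and nonnegativity lets the squares be removed. *)
Lemma thin_svd_unique (R : realType) m n (A : 'M[R]_(m, n)) U s V U' s' V' :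
  thin_svd A U s V -> thin_svd A U' s' V' -> s = s'.
Proof.
move=> svdA svdA'.
have charE (W : 'M[R]_m) t (Z : 'M[R]_(n, m)) : thin_svd A W t Z ->
    char_poly (A *m A^T) = \prod_(x <- [seq t 0 i ^+ 2 | i <- enum 'I_m]) ('X - x%:P).
  move=> svdW; rewrite (thin_svd_mulmx_tr svdW) char_poly_conj.
    rewrite char_poly_diag; congr (\prod_(x <- _) _).
    by apply: eq_map => i; rewrite mxE.
  by case: svdW => WW _ _ _ _; exact: mulmx1C.
have sqr_sorted (W : 'M[R]_m) t (Z : 'M[R]_(n, m)) : thin_svd A W t Z ->
    sorted >=%R [seq t 0 i ^+ 2 | i <- enum 'I_m].
  move=> [_ _ t0 t_dec _]; rewrite sorted_map.
  have : sorted (fun i j : 'I_m => (i <= j)%N) (enum 'I_m).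
    by rewrite -(@sorted_map _ _ val leq) val_enum_ord iota_sorted.
  apply: sub_sorted => i j ij.
  by rewrite /= lerXn2r ?nnegrE ?t0 ?t_dec.
have sqr_eq : [seq s 0 i ^+ 2 | i <- enum 'I_m] = [seq s' 0 i ^+ 2 | i <- enum 'I_m].
  apply: (@sorted_eq _ >=%R) (sqr_sorted _ _ _ svdA) (sqr_sorted _ _ _ svdA') _.
  - exact: ge_trans.
  - exact: ge_anti.
  - by apply: prod_XsubC_eq; rewrite -(charE _ _ _ svdA) (charE _ _ _ svdA').
case: svdA svdA' => _ _ s0 _ _ [_ _ s'0 _ _].
apply/rowP => i; apply/eqP; rewrite -(@eqrXn2 _ 2) //; apply/eqP.
by move/eq_in_map: sqr_eq; apply; rewrite mem_enum.
Qed.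

Lemma singular_valuesE (R : realType) m n (A : 'M[R]_(m, n)) U s V :
  thin_svd A U s V -> singular_values A = s.
Proof.
move=> svdA; apply: xget_unique => [|s' [U' [V' svdA']]]; first by exists U, V.
exact: thin_svd_unique svdA' svdA.
Qed.

(** * Projection onto the unit ball by clipping singular values at 1 *)

Section ClippedSVD.
Variables (R : realType) (m n : nat) (A : 'M[R]_(m, n)).
Variables (U : 'M[R]_m) (s : 'rV[R]_m) (V : 'M[R]_(n, m)).
Hypothesis svdA : thin_svd A U s V.

Let c : 'rV[R]_m := \row_i Num.min (s 0 i) 1.
Let B : 'M[R]_(m, n) := U *m diag_mx c *m V^T.

Lemma thin_svd_clip : thin_svd B U c V.
Proof.
case: svdA => UU VV s0 s_dec _; split=> //.
  by move=> i; rewrite mxE le_min s0 ler01.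
move=> i j ij; rewrite !mxE le_min !ge_min lexx orbT andbT.
by rewrite s_dec.
Qed.

(** [V^T] does not increase the norm, the diagonal factors lie in [[0, 1]], and [U] preserves the
    norm. *)
Lemma op_norm_clip : op_norm B <= 1.
Proof.
case: thin_svd_clip => UU VV c0 _ _; apply/op_norm_le1P => v v1.
rewrite /B -!mulmxA frob_dot_isometry //.
apply: le_trans (le_trans (frob_dot_trmx_isometry_le v VV) v1).
rewrite mul_diag_mx !frob_dotE; apply: ler_sum => j _; apply: ler_sum => i _.
rewrite !mxE -!expr2 exprMn ler_piMl ?sqr_ge0 // expr_le1 //.
  by rewrite ge_min lexx orbT.
by have := c0 i; rewrite mxE.
Qed.

Lemma frob_dot_clip_le0 (T : 'M[R]_(m, n)) :
  op_norm T <= 1 -> frob_dot (T - B) (A - B) <= 0.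
Proof.
move=> T1; case: svdA => UU VV s0 _ AE.
have ABE : A - B = U *m diag_mx (s - c) *m V^T.
  by rewrite AE /B -mulmxBl -mulmxBr [diag_mx (s - c)]raddfB.
(* Cyclicity of the trace moves [U] and [V] onto [T - B], so that only the diagonal of
   [U^T (T - B) V] meets [s - c]. *)
have -> : frob_dot (T - B) (A - B) =
    \sum_i (s 0 i - c 0 i) * ((U^T *m T *m V) i i - c 0 i).
  rewrite frob_dotC /frob_dot ABE !trmx_mul trmxK tr_diag_mx.
  rewrite -!mulmxA mxtrace_mulC -!mulmxA mul_diag_mx /mxtrace.
  apply: eq_bigr => i _; rewrite mxE mulmxBl mulmxBr.
  rewrite /B !mulmxA UU mul1mx -(mulmxA _ V^T) VV mulmx1.
  by rewrite !mxE eqxx mulr1n.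
apply: sumr_le0 => i _.
rewrite [c 0 i]mxE; case: (leP (s 0 i) 1) => [_|s1]; first by rewrite subrr mul0r.
rewrite mulr_ge0_le0 // ?subr_ge0 ?(ltW s1) // subr_le0.
pose e : 'cV[R]_m := delta_mx i 0.
have ee : frob_dot e e = 1.
  by rewrite frob_dot_cVE trmx_delta mul_delta_mx mxE !eqxx.
(* The diagonal entry is the inner product of the column [u_i] with [T v_i]; the former is a unit
   vector, and the latter has norm at most 1 because [v_i] is a unit vector. *)
have -> : (U^T *m T *m V) i i = frob_dot (U *m e) (T *m (V *m e)).
  rewrite frob_dot_cVE trmx_mul trmx_delta -!mulmxA -rowE [RHS]mxE.
  by rewrite !(mulmxA _ _ e) -colE [RHS]mxE.
apply: frob_dot_le1; first by rewrite frob_dot_isometry // ee.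
by move/op_norm_le1P: T1; apply; rewrite frob_dot_isometry // ee.
Qed.

(** Writing [T - A = (T - B) - (A - B)], the cross term has the favourable sign. Keeping the term
    [|T - B|^2] yields uniqueness of the minimizer as well as minimality. *)
Lemma frob_dist_clip (T : 'M[R]_(m, n)) : op_norm T <= 1 ->
  frob_dot (B - A) (B - A) + frob_dot (T - B) (T - B) <= frob_dot (T - A) (T - A).
Proof.
move=> /frob_dot_clip_le0; rewrite -[T - A](subrKA B) -[B - A]opprB.
rewrite (frob_dot_sqB (T - B) (A - B)).
have -> : frob_dot (- (A - B)) (- (A - B)) = frob_dot (A - B) (A - B).
  by rewrite frob_dotNr frob_dotC frob_dotNr opprK.
lra.
Qed.

Lemma argmin_clip :
  argmin [set T | op_norm T <= 1] (fun T => 2^-1 * frob_norm (T - A) ^+ 2) = [set B].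
Proof.
apply/seteqP; split=> [T [/= T1 Tmin]|_ ->].
  have := Tmin B op_norm_clip; rewrite !sqr_frob_norm => TB.
  have := frob_dist_clip T1; have := frob_dot_ge0 (T - B) => TB0 dist.
  by apply/eqP; rewrite -subr_eq0; apply/eqP/frob_dot_eq0; lra.
split=> [|T T1 /=]; first exact: op_norm_clip.
rewrite !sqr_frob_norm.
have := frob_dist_clip T1; have := frob_dot_ge0 (T - B); lra.
Qed.

End ClippedSVD.

(** The two objectives add up to the constant [|A|^2 / 2]. *)
Lemma argmax_argmin (R : realType) m n (S : set 'M[R]_(m, n)) (A : 'M[R]_(m, n)) :
  argmax S (fun T => frob_dot A T - 2^-1 * frob_norm T ^+ 2) =
  argmin S (fun T => 2^-1 * frob_norm (T - A) ^+ 2).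
Proof.
have objE T : 2^-1 * frob_norm (T - A) ^+ 2 = 2^-1 * frob_dot A A
    - (frob_dot A T - 2^-1 * frob_norm T ^+ 2).
  rewrite !sqr_frob_norm frob_dot_sqB (frob_dotC T A); lra.
by apply/seteqP; split=> T [ST Topt]; split=> // T' /Topt; rewrite !objE; lra.
Qed.

Theorem proposition1 (R : realType) (m n : nat) (X : 'M[R]_(m, n))
    (U : 'M[R]_m) (s : 'rV[R]_m) (V : 'M[R]_(n, m))
    (X_rows : forall i, row i X != 0)
    (svd : thin_svd (row_normalize X) U s V)
    (Gamma_pd : loewner_lt 0 (Gamma X)) :
  let Psi := row_normalize X in
  let lambda := \row_i (s 0 i) ^+ 2 in
  let P := U *m diag_mx (\row_i Num.min 1 (Num.sqrt (lambda 0 i))^-1) *m U^T in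
  let T_plus := P *m Psi in
  let ball := [set T : 'M[R]_(m, n) | op_norm T <= 1] in
  [/\ argmin ball (fun T => 2^-1 * frob_norm (T - Psi) ^+ 2) =
        [set T_plus],
      argmax ball (fun T => frob_dot Psi T - 2^-1 * frob_norm T ^+ 2) =
        [set T_plus],
      loewner_lt 0 P,
      loewner_le P 1%:M
    & forall i, singular_values T_plus 0 i = Num.min (s 0 i) 1].
Proof.
move=> Psi lambda P T_plus ball.
have [UU VV s_ge0 _ PsiE] := svd; have UUT := mulmx1C UU.
(* Positive definiteness of [Gamma X] makes every [s_i^2] positive, so the inverses in [P] are
   genuine and not the default [0^-1 = 0]. *)
have s_gt0 i : 0 < s 0 i.
  move: Gamma_pd; rewrite /loewner_lt subr0 /Gamma (thin_svd_mulmx_tr svd).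
  move=> /(posdef_conj_diag_gt0 UU)/(_ i).
  by rewrite mxE lt_def sqrf_eq0 sqr_ge0 andbT lt_def s_ge0 andbT.
have lambdaE i : Num.sqrt (lambda 0 i) = s 0 i by rewrite mxE sqrtr_sqr ger0_norm.
(* [U^T U = 1] merges the two diagonal factors, and [min(1, 1/s_i) * s_i = min(s_i, 1)]. *)
have T_plusE : T_plus = U *m diag_mx (\row_i Num.min (s 0 i) 1) *m V^T.
  rewrite /T_plus /P {1}/Psi PsiE !mulmxA -(mulmxA _ U^T) UU mulmx1.
  rewrite -(mulmxA U) mulmx_diag; congr (_ *m diag_mx _ *m _).
  apply/rowP => i; rewrite !mxE sqrtr_sqr ger0_norm //.
  by rewrite minr_pMl ?s_ge0 // mul1r mulVf ?gt_eqF.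
split.
- by rewrite T_plusE (argmin_clip svd).
- by rewrite argmax_argmin T_plusE (argmin_clip svd).
- rewrite /loewner_lt subr0; apply: posdef_conj_diag UUT _ => i.
  by rewrite mxE lambdaE lt_min ltr01 invr_gt0 s_gt0.
- rewrite /loewner_le.
  (* Since [U U^T = 1], the identity is diagonal in the same basis, and the eigenvalues of the
     difference are [1 - min(1, 1/s_i)]. *)
  have -> : 1%:M - P =
      U *m diag_mx (const_mx 1 - \row_i Num.min 1 (Num.sqrt (lambda 0 i))^-1) *m U^T.
    by rewrite raddfB mulmxBr mulmxBl /= diag_const_mx mulmx1 UUT.
  by apply: possemidef_conj_diag => i; rewrite !mxE subr_ge0 ge_min lexx.
- by move=> i; rewrite T_plusE (singular_valuesE (thin_svd_clip svd)) mxE.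
Qed.
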